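(* Let $Q$ be a measurable $4\times4$ matrix-valued function on $B_1^c$ with $\|Q(\mathbf{x})\|_{\mathbb{C}^4}=O(|\mathbf{x}|^{-1})$ in $B_1^c$, i.e. $\|Q(\mathbf{x})\|_{\mathbb{C}^4}\le C_0|\mathbf{x}|^{-1}$ for some constant $C_0$ and all $\mathbf{x}\in B_1^c$. Suppose that $\psi\in\left(L^2(B_1^c)\right)^4$ satisfies $\{(\boldsymbol{\alpha}\cdot\mathbf{p})+Q(\mathbf{x})\}\psi(\mathbf{x})=0$ in $B_1^c$. Then for any $t$ with $0<t<11/10$, $\psi(\mathbf{x})=|\mathbf{x}|^{-2-t}\phi(\mathbf{x})$, where $$\int_{B_1^c}|\phi(\mathbf{x})|^s\,|\mathbf{x}|^{-6}\,d\mathbf{x}<\infty$$ for any $s\in[1,4/3)$.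
   Context: $B_1$ is the open unit ball in $\mathbb{R}^3$ centred at the origin and $B_1^c=\mathbb{R}^3\setminus B_1$. $\|\cdot\|_{\mathbb{C}^4}$ is any matrix norm on $4\times4$ complex matrices, and $|\cdot|$ is the Euclidean norm on $\mathbb{R}^3$ or $\mathbb{C}^4$. $\boldsymbol{\alpha}=(\alpha_1,\alpha_2,\alpha_3)$ is the triple of Dirac matrices, $\alpha_j=\begin{pmatrix}0_2&\sigma_j\\ \sigma_j&0_2\end{pmatrix}$, where $0_2$ is the $2\times2$ zero matrix and $\sigma_1=\begin{pmatrix}0&1\\1&0\end{pmatrix}$, $\sigma_2=\begin{pmatrix}0&-i\\ i&0\end{pmatrix}$, $\sigma_3=\begin{pmatrix}1&0\\0&-1\end{pmatrix}$. $\mathbf{p}=-i\nabla$, so $\boldsymbol{\alpha}\cdot\mathbf{p}=-i\sum_{j=1}^3\alpha_j\,\partial/\partial x_j$. The equation is understood in the weak sense, i.e. in the sense of distributions tested against all $\varphi\in\left(C_0^\infty(\mathbb{R}^3\setminus\overline{B_1})\right)^4$. *)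

(* Defs.v *)
From HB Require Import structures.
From mathcomp Require Import all_boot all_order all_algebra.
From mathcomp Require Import complex.
From mathcomp Require Import all_classical all_reals all_analysis.
From mathcomp Require Import measurable_realfun.

Set Implicit Arguments.
Unset Strict Implicit.
Unset Printing Implicit Defensive.

Import Order.TTheory GRing.Theory Num.Theory.
Import numFieldNormedType.Exports.

Local Open Scope classical_set_scope.
Local Open Scope ring_scope.

(* The library's norm on this product is the maximum norm: it is used only
   for the topology and for derivatives, the Euclidean norm being [enorm]. *)
Notation R3 R := (R * R * R)%type.

Section Space.
Context {R : realType}.

Definition enorm (x : R3 R) : R :=
  Num.sqrt (x.1.1 ^+ 2 + x.1.2 ^+ 2 + x.2 ^+ 2).

Local Notation mR := (measurableTypeR R).

Definition lebesgue3 : set (mR * mR * mR) -> \bar R :=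
  ((@lebesgue_measure R \x @lebesgue_measure R) \x @lebesgue_measure R)%E.
HB.instance Definition _ := Measure.on lebesgue3.

Definition basis3 (j : 'I_3) : R3 R :=
  ((j == 0 :> nat)%:R, (j == 1%N :> nat)%:R, (j == 2%N :> nat)%:R).

Definition B1 : set (R3 R) := [set x | enorm x < 1].
Definition B1c : set (R3 R) := ~` B1.

(* Lebesgue (not only Borel) measurability on D: preimages of Borel sets
   belong to the completed sigma-algebra. On such functions the library's
   integral, a supremum over Borel simple functions lying below the positive
   and negative parts, still is the Lebesgue integral. *)
Definition lebesgue_measurable_fun (D : set (R3 R)) (f : R3 R -> R) :=
  forall Y : set R, measurable Y ->
    completed_algebra_gen lebesgue3 (D `&` f @^-1` Y).

Definition iter_partial (f : R3 R -> R) (js : seq 'I_3) : R3 R -> R :=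
  foldr (fun j g => 'D_(basis3 j) g) f js.

Definition smooth (f : R3 R -> R) :=
  forall js : seq 'I_3, continuous (iter_partial f js) /\
    forall (j : 'I_3) (x : R3 R), derivable (iter_partial f js) x (basis3 j).

End Space.

Section Spinors.
Context {R : realType}.
Local Notation C := R[i].
Local Notation Re := complex.Re.
Local Notation Im := complex.Im.
Local Open Scope complex_scope.

Definition mx_lebesgue_measurable m n (D : set (R3 R))
    (F : R3 R -> 'M[C]_(m, n)) :=
  forall i j, lebesgue_measurable_fun D (fun x => Re (F x i j)) /\
              lebesgue_measurable_fun D (fun x => Im (F x i j)).

(* Nonnegativity and [nrm 0 = 0] follow from these axioms. *)
Definition is_norm m n (nrm : 'M[C]_(m, n) -> R) :=
  [/\ forall A, nrm A = 0 -> A = 0,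
      forall (a : C) A, nrm (a *: A) = Normc.normc a * nrm A &
      forall A B, nrm (A + B) <= nrm A + nrm B].

Definition cnorm n (v : 'cV[C]_n) : R :=
  Num.sqrt (\sum_(k < n) Normc.normc (v k 0) ^+ 2).

Definition cdot n (u v : 'cV[C]_n) : C := \sum_(k < n) u k 0 * conjc (v k 0).

Definition mx2 (a b c d : C) : 'M[C]_2 :=
  block_mx (a%:M : 'M[C]_1) (b%:M : 'M[C]_1) (c%:M : 'M[C]_1) (d%:M : 'M[C]_1).

Definition pauli_mx (j : 'I_3) : 'M[C]_2 :=
  nth 0 [:: mx2 0 1 1 0; mx2 0 (- 'i%C) 'i%C 0; mx2 1 0 0 (-1)] j.

Definition dirac_mx (j : 'I_3) : 'M[C]_4 :=
  block_mx (0 : 'M[C]_2) (pauli_mx j) (pauli_mx j) (0 : 'M[C]_2).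

Definition partialC n (j : 'I_3) (f : R3 R -> 'cV[C]_n) (x : R3 R) : 'cV[C]_n :=
  \col_k ('D_(basis3 j) (fun y => Re (f y k 0)) x +i*
          'D_(basis3 j) (fun y => Im (f y k 0)) x).

Definition dirac_op (f : R3 R -> 'cV[C]_4) (x : R3 R) : 'cV[C]_4 :=
  - 'i%C *: \sum_(j < 3) dirac_mx j *m partialC j f x.

Definition test_fun n (U : set (R3 R)) (f : R3 R -> 'cV[C]_n) :=
  [/\ forall k, smooth (fun x => Re (f x k 0)) /\ smooth (fun x => Im (f x k 0)),
      compact (closure [set x | f x != 0]) &
      closure [set x | f x != 0] `<=` U].

(* The real Lebesgue integral defaults to a junk value on nonintegrable
   functions; it is applied below to integrands that are integrable because
   psi is in L^2, Q is bounded and f has compact support. *)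
Definition Cintegral (D : set (R3 R)) (f : R3 R -> C) : C :=
  (\int[lebesgue3]_(x in D) Re (f x)) +i* (\int[lebesgue3]_(x in D) Im (f x)).

Definition L2_on n (D : set (R3 R)) (f : R3 R -> 'cV[C]_n) :=
  mx_lebesgue_measurable D f /\
  (\int[lebesgue3]_(x in D) (cnorm (f x) ^+ 2)%:E < +oo)%E.

(* The operator alpha.p, formally self-adjoint, is moved onto the test
   function in the inner product of C^4. *)
Definition weak_dirac_solution (Q : R3 R -> 'M[C]_4) (psi : R3 R -> 'cV[C]_4) :=
  forall f : R3 R -> 'cV[C]_4, test_fun (~` closure B1) f ->
    Cintegral B1c (fun x => cdot (psi x) (dirac_op f x) +
                            cdot (Q x *m psi x) (f x)) = 0.

End Spinors.

(* Main.v *)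
Require Import Defs.
From HB Require Import structures.
From mathcomp Require Import all_boot all_order all_algebra.
From mathcomp Require Import complex.
From mathcomp Require Import all_classical all_reals all_analysis.
From mathcomp Require Import measurable_realfun.
From mathcomp Require Import ring lra.

(* With u = |x|^2 |psi x| and phi = |x|^(2+t) psi, and since |x| >= 1, t s <= 2
   and s <= 2,
     |phi|^s |x|^-6 = |x|^(t s - 6) u^s <= |x|^-4 (1 + u^2) = |x|^-4 + |psi|^2.
   The first term is integrable at infinity in dimension 3 and the second one
   because psi is in L^2: the decay follows from square integrability alone,
   whatever the equation satisfied by psi. *)

Set Implicit Arguments.
Unset Strict Implicit.
Unset Printing Implicit Defensive.

Import Order.TTheory GRing.Theory Num.Theory.
Import numFieldNormedType.Exports.
Import HBNNSimple.

Local Open Scope classical_set_scope.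
Local Open Scope ring_scope.
Local Open Scope complex_scope.

(** * Completion of a sigma-algebra by negligible sets *)

Section CompletedAlgebra.
Context d (T : measurableType d) (R : realType).
Variable mu : {measure set T -> \bar R}.

(** Lets the completed sets serve as the sigma-algebra of a measurable type, so that facts about
    measurable functions apply to Lebesgue measurable ones. *)
Lemma sigma_algebra_completed_algebra_gen :
  sigma_algebra setT (completed_algebra_gen mu).
Proof.
split=> /=.
- by exists set0 => //; exists set0; [exact: negligible_set0|rewrite setU0].
- move=> _ [A mA [N [F [mF F0 NF]] <-]].
  (* With [N] inside the measurable null set [F], the complement of [A] and [N] splits into a
     measurable part outside [F] and a negligible remainder inside [F]. *)
  exists (~` A `\` F).
    by apply: measurableD => //; exact: measurableC.
  exists (~` A `&` (F `\` N)).
    by exists F; split => // x [_ []].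
  rewrite setTD; apply/seteqP; split => x /=.
    by move=> [[nA nF]|[nA [Fx nN]]] [//|Nx]; [apply: nF; exact: NF|].
  move=> /not_orP[nA nN]; have [Fx|nF] := pselect (F x); first by right.
  by left.
- move=> G mG.
  have /choice[A HA] k : exists A, measurable A /\
      exists2 N, mu.-negligible N & A `|` N = G k.
    by have [A mA [N nN AN]] := mG k; exists A; split => //; exists N.
  have /choice[N HN] k : exists N, mu.-negligible N /\ A k `|` N = G k.
    by have [_ [N nN AN]] := HA k; exists N.
  exists (\bigcup_k A k); first by apply: bigcupT_measurable => k; case: (HA k).
  exists (\bigcup_k N k); first by apply: negligible_bigcup => k; case: (HN k).
  by rewrite -bigcupU; apply: eq_bigcup => // k _; case: (HN k).
Qed.

Lemma measurable_completed_algebra_gen :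
  measurable `<=` completed_algebra_gen mu.
Proof.
by move=> A mA; exists A => //; exists set0;
  [exact: negligible_set0|rewrite setU0].
Qed.

End CompletedAlgebra.

(* The library's integral of a nonnegative f that need not be measurable is a
   supremum over simple functions below f, and is not subadditive in general. *)
Lemma integral_le_addr_measurable d (T : measurableType d) (R : realType)
    (mu : {measure set T -> \bar R}) (D : set T) (h f g : T -> \bar R) :
  (forall x, 0 <= h x)%E -> (forall x, 0 <= f x)%E -> (forall x, 0 <= g x)%E ->
  measurable_fun setT g -> (forall x, D x -> h x <= f x + g x)%E ->
  (\int[mu]_(x in D) h x <= \int[mu]_(x in D) f x + \int[mu]_x g x)%E.
Proof.
move=> h0 f0 g0 mg hfg.
have fD0 x : (0 <= (f \_ D) x)%E by rewrite /patch; case: ifP.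
rewrite integral_mkcond [in leRHS]integral_mkcond.
rewrite [leLHS]ge0_integralTE; last by move=> x; rewrite /patch; case: ifP.
apply: ge_ereal_sup => _ [/= k kh <-]; rewrite -integralT_nnsfun.
have k0 x : (0 <= (k x)%:E)%E by rewrite lee_fin.
have mk : measurable_fun setT (EFin \o k) by exact/measurable_EFinP.
(* Only [h] and [f] may fail to be measurable. For a simple [k] below [h], the truncated difference
   [l] is measurable, lies below [f] extended by zero, and satisfies [k <= l + g]; additivity is
   then used for [l] and [g] only. *)
pose l x := maxe ((k x)%:E - g x)%E 0%E.
have l0 x : (0 <= l x)%E by rewrite le_max lexx orbT.
have ml : measurable_fun setT l.
  by apply: measurable_maxe => //; exact: emeasurable_funB.
have klg x : ((k x)%:E <= l x + g x)%E.
  rewrite /l; have := g0 x; case: (g x) => [r _| _|//].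
    by rewrite -EFinB -EFin_max -EFinD lee_fin -lerBlDr le_max lexx.
  rewrite addeC /= addye ?leey// gt_eqF// (lt_le_trans ltNy0)//.
  by rewrite le_max lexx orbT.
have lf x : (l x <= (f \_ D) x)%E.
  rewrite ge_max fD0 andbT.
  have [->|gy] := eqVneq (g x) +oo%E; first by rewrite addeNy leNye.
  have gfin : g x \is a fin_num by rewrite ge0_fin_numE// ltey.
  rewrite leeBlDr//; apply: (le_trans (kh x)); rewrite /patch.
  case: (boolP (x \in D)) => [/set_mem/hfg //|_].
  by rewrite add0e.
apply: (@le_trans _ _ (\int[mu]_x (l x + g x))%E).
  by apply: ge0_le_integral => //; exact: emeasurable_funD.
rewrite ge0_integralD// leeD2r//.
(* The comparison with the possibly non-measurable [f \_ D] is read off the two suprema: a simple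
   function below [l] is also below [f \_ D]. *)
rewrite [leLHS]ge0_integralTE// [leRHS]ge0_integralTE//.
apply: ge_ereal_sup => _ [/= k' kl <-]; apply: ereal_sup_ubound.
by exists k' => // x; exact: le_trans (kl x) (lf x).
Qed.

(** * Measurability on R^3 and an integrable Borel majorant of |x|^-4 *)

Section Space.
Context {R : realType}.
Local Notation mR := (measurableTypeR R).

Lemma lebesgue_measurable_funM (D : set (R3 R)) (f g : R3 R -> R) :
  measurable_fun (setT : set (mR * mR * mR)) f -> lebesgue_measurable_fun D g ->
  measurable (D : set (mR * mR * mR)) ->
  lebesgue_measurable_fun D (f \* g).
Proof.
move=> mf mg mD Y mY.
pose mu : {measure set (mR * mR * mR) -> \bar R} := @lebesgue3 R.
have sa := sigma_algebra_completed_algebra_gen mu.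
(* [T'] is R^3 with the Lebesgue sigma-algebra: [subC] and [subI] identify its measurable sets with
   the completed ones, and the product rule is applied there. *)
pose T' := g_sigma_algebraType (completed_algebra_gen mu).
have subC (A : set T') : completed_algebra_gen mu A -> measurable A.
  exact: sub_sigma_algebra.
have subI (A : set T') : measurable A -> completed_algebra_gen mu A.
  by apply: smallest_sub.
have mD' : measurable (D : set T').
  by apply: subC; exact: measurable_completed_algebra_gen.
apply: subI.
have : measurable_fun (D : set T') (f \* g : T' -> R).
  apply: measurable_funM.
    move=> _ Z mZ; apply: subC; apply: measurable_completed_algebra_gen.
    by apply: measurableI => //; rewrite -[_ @^-1` _]setTI; exact: mf.
  by move=> _ Z mZ; apply: subC; exact: mg.
by apply.
Qed.

Lemma enorm_ge0 (x : R3 R) : 0 <= enorm x.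
Proof. exact: sqrtr_ge0. Qed.

Lemma enorm_le (x : R3 R) (a : R) : enorm x <= a ->
  [/\ `|x.1.1| <= a, `|x.1.2| <= a & `|x.2| <= a].
Proof.
move=> xa; rewrite -!sqrtr_sqr.
by split; apply: le_trans xa; apply: ler_wsqrtr; nra.
Qed.

Lemma measurable_enorm : measurable_fun (setT : set (mR * mR * mR)) (@enorm R).
Proof.
have m1 := @measurable_fst _ _ (mR * mR)%type mR.
have m2 := @measurable_snd _ _ (mR * mR)%type mR.
suff mq : measurable_fun (setT : set (mR * mR * mR))
    (fun x => x.1.1 ^+ 2 + x.1.2 ^+ 2 + x.2 ^+ 2 : R).
  exact: (measurableT_comp (continuous_measurable_fun (@sqrt_continuous R)) mq).
apply: measurable_funD; last exact: measurable_funX.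
apply: measurable_funD; apply: measurable_funX.
- exact: (measurableT_comp (@measurable_fst _ _ mR mR)).
- exact: (measurableT_comp (@measurable_snd _ _ mR mR)).
Qed.

Lemma measurable_B1c : measurable (@B1c R : set (mR * mR * mR)).
Proof.
apply: measurableC.
have -> : @B1 R = setT `&` @enorm R @^-1` `]-oo, 1[.
  by apply/seteqP; split => x /=; rewrite in_itv //= => -[].
exact: measurable_enorm.
Qed.

Definition cube (a : R) : set (mR * mR * mR) :=
  (`[- a, a] `*` `[- a, a]) `*` `[- a, a].

Lemma measurable_cube a : measurable (cube a).
Proof. by do 2?apply: measurableX. Qed.

Lemma lebesgue3_cube a : 0 < a -> lebesgue3 (cube a) = ((2 * a) ^+ 3)%:E.
Proof.
move=> a0.
have I : lebesgue_measure (`[- a, a] : set mR) = (2 * a)%:E.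
  rewrite lebesgue_measure_itv /= lte_fin.
  by rewrite ifT; [rewrite -EFinB; congr _%:E; lra|lra].
have I2 := @product_measure1E _ _ mR mR R lebesgue_measure lebesgue_measure
  _ _ (measurable_itv `[- a, a]) (measurable_itv `[- a, a]).
apply: etrans (@product_measure1E _ _ (mR * mR)%type mR R
  (lebesgue_measure \x lebesgue_measure)%E lebesgue_measure _ _
  (measurableX (measurable_itv _) (measurable_itv _)) (measurable_itv _)) _.
rewrite (congr2 mule (etrans I2 (congr2 mule I I)) I) -!EFinM.
by rewrite !exprS expr0 mulr1 mulrA.
Qed.

(** A Borel substitute for |x|^-4 outside the unit ball. Being a series of weighted indicators of
    cubes, it is integrated from cube volumes alone, without polar coordinates. *)
Definition dyadic_majorant (x : mR * mR * mR) : \bar R :=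
  (\sum_(k <oo) ((2 ^+ k) ^- 4)%:E * (\1_(cube (2 ^+ k.+1)) x)%:E)%E.

Let term_ge0 k x :
  (0 <= ((2 ^+ k : R) ^- 4)%:E * (\1_(cube (2 ^+ k.+1)) x)%:E)%E.
Proof. by rewrite -EFinM lee_fin mulr_ge0// invr_ge0 !exprn_ge0. Qed.

Let measurable_indic_cube (a : R) :
  measurable_fun setT (fun x => (\1_(cube a) x : R)%:E).
Proof.
by apply/measurable_EFinP; apply: measurable_indic; exact: measurable_cube.
Qed.

Let measurable_term k : measurable_fun setT
  (fun x => ((2 ^+ k : R) ^- 4)%:E * (\1_(cube (2 ^+ k.+1)) x)%:E)%E.
Proof. exact: emeasurable_funM. Qed.

Lemma dyadic_majorant_ge0 x : (0 <= dyadic_majorant x)%E.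
Proof. by apply: nneseries_ge0 => k _ _; exact: term_ge0. Qed.

Lemma measurable_dyadic_majorant : measurable_fun setT dyadic_majorant.
Proof. by apply: ge0_emeasurable_sum => // k x _ _; exact: term_ge0. Qed.

Lemma integral_dyadic_majorant :
  (\int[lebesgue3]_x dyadic_majorant x < +oo)%E.
Proof.
rewrite integral_nneseries//.
(* The cube of half-side 2^(k+1) has volume 2^(3k+6), so the k-th term contributes 64 / 2^k, written
   128 / 2^(k+1) to match the geometric series of ratio 1/2. *)
have E k : (\int[lebesgue3]_x (((2 ^+ k : R) ^- 4)%:E *
    (\1_(cube (2 ^+ k.+1)) x)%:E) = (128%:R / (2 ^ (k + 1))%:R)%:E)%E.
  rewrite ge0_integralZl_EFin//.
  rewrite integral_indic ?setIT//; last exact: measurable_cube.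
  have p0 : (0 : R) < 2 ^+ k by rewrite exprn_gt0.
  have c0 : (0 : R) < 2 ^+ k.+1 by rewrite exprn_gt0.
  rewrite [X in (_ * X)%E](lebesgue3_cube c0) -EFinM; congr _%:E.
  rewrite addn1 natrX !exprS.
  by field; exact: lt0r_neq0.
under eq_eseriesr do rewrite E.
have -> := cvg_lim _ (@cvg_geometric_eseries_half R 128%:R 0) => //.
by rewrite ltry.
Qed.

Lemma dyadic_majorant_ge (x : R3 R) : 1 <= enorm x ->
  (((enorm x) ^- 4)%:E <= dyadic_majorant x)%E.
Proof.
move=> x1; have x0 : 0 < enorm x by exact: lt_le_trans x1.
have ex : exists n : nat, enorm x < 2 ^+ n.+1.
  exists (Num.truncn (enorm x)).
  apply: (lt_le_trans (truncnS_gt _)); rewrite -natrX ler_nat.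
  exact/ltnW/ltn_expl.
(* Minimality of [n] places x in the dyadic shell 2^n <= |x| < 2^(n+1); for [n = 0] the lower bound
   is the hypothesis 1 <= |x|. *)
case: (ex_minnP ex) => n xn nmin.
have xn' : 2 ^+ n <= enorm x.
  case: n nmin {xn} => [_|n nmin]; first by rewrite expr0.
  by rewrite leNgt; apply/negP => /nmin; rewrite ltnn.
have cx : cube (2 ^+ n.+1) x.
  by have [? ? ?] := enorm_le (ltW xn); split; [split|];
    rewrite /= in_itv /= -ler_norml.
apply: (@le_trans _ _ ((2 ^+ n) ^- 4)%:E).
  rewrite lee_fin lef_pV2 ?posrE ?exprn_gt0//.
  by rewrite lerXn2r// nnegrE ?exprn_ge0// ltW.
(* The partial sum of length [n.+1] ends with the term of index [n], whose cube contains x; the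
   earlier terms are nonnegative. *)
apply: (le_trans _ (nneseries_lim_ge n.+1 (fun k _ _ => term_ge0 k x))).
rewrite big_nat_recr//= indicE mem_set// mule1.
by apply: leeDr; apply: sume_ge0 => k _; exact: term_ge0.
Qed.

End Space.

(** * Pointwise weighted bound and conclusion *)

Lemma weighted_powR_le (R : realType) (r m s t : R) :
  1 <= r -> 0 <= m -> 0 <= s -> s <= 2 -> t * s <= 2 ->
  (r `^ (2 + t) * m) `^ s * r ^- 6 <= m ^+ 2 + r ^- 4.
Proof.
move=> r1 m0 s0 s2 ts2; have r0 : 0 < r by exact: lt_le_trans r1.
have rn0 := lt0r_neq0 r0.
pose u := r ^+ 2 * m.
have u0 : 0 <= u by rewrite mulr_ge0// exprn_ge0// ltW.
have -> : r `^ (2 + t) * m = r `^ t * u.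
  rewrite powRD; last by rewrite rn0 implybT.
  by rewrite powR_mulrn ?(ltW r0)// /u mulrA [_ ^+ 2 * _]mulrC.
rewrite powRM ?powR_ge0// -powRrM.
have rts : r `^ (t * s) <= r ^+ 2 by rewrite -powR_mulrn ?(ltW r0)// ler_powR.
(* The power is at most u^2 when u >= 1, by s <= 2, and at most 1 when u < 1, by s >= 0. *)
have us : u `^ s <= 1 + u ^+ 2.
  have [u1|u1] := lerP 1 u.
    apply: (@le_trans _ _ (u ^+ 2)); last by rewrite lerDr.
    by rewrite -powR_mulrn// ler_powR.
  apply: (@le_trans _ _ 1); last by rewrite lerDl sqr_ge0.
  have <- : 1 `^ s = 1 :> R by rewrite powR1.
  by rewrite ge0_ler_powR ?nnegrE// ltW.
have -> : m ^+ 2 + r ^- 4 = (r ^+ 2 * (1 + u ^+ 2)) * r ^- 6.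
  by rewrite /u; field.
by rewrite ler_wpM2r ?invr_ge0 ?exprn_ge0 ?(ltW r0)// ler_pM ?powR_ge0.
Qed.

Lemma cnormZ (R : realType) n (a : R) (v : 'cV[R[i]]_n) : 0 <= a ->
  cnorm (a%:C *: v) = a * cnorm v.
Proof.
move=> a0; rewrite /cnorm.
under eq_bigr do rewrite mxE Normc.normcM exprMn.
rewrite -mulr_sumr sqrtrM ?sqr_ge0// sqrtr_sqr.
by rewrite /= expr0n addr0 sqrtr_sqr normr_id ger0_norm.
Qed.

Theorem theorem4 (R : realType)
    (nrm : 'M[R[i]]_4 -> R) (nrmP : is_norm nrm)
    (Q : R3 R -> 'M[R[i]]_4) (Qmeas : mx_lebesgue_measurable B1c Q)
    (Qbound : exists C0 : R, forall x, B1c x -> nrm (Q x) <= C0 * (enorm x)^-1)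
    (psi : R3 R -> 'cV[R[i]]_4) (psiL2 : L2_on B1c psi)
    (psi_sol : weak_dirac_solution Q psi)
    (t : R) (t_gt0 : 0 < t) (t_lt : t < 11%:R / 10%:R) :
  exists phi : R3 R -> 'cV[R[i]]_4,
    [/\ mx_lebesgue_measurable B1c phi,
        forall x, B1c x -> psi x = (enorm x `^ (- 2 - t))%:C *: phi x &
        forall s : R, 1 <= s -> s < 4%:R / 3%:R ->
          (\int[lebesgue3]_(x in B1c)
             (cnorm (phi x) `^ s * (enorm x) ^- 6)%:E < +oo)%E].
Proof.
have [psi_meas psi_fin] := psiL2.
have B1cE x : B1c x -> 1 <= enorm x by move=> /negP; rewrite -leNgt.
exists (fun x => (enorm x `^ (2 + t))%:C *: psi x); split.
(* The weight is Borel and real, so it multiplies the real and imaginary parts of [psi] separately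
   and keeps them Lebesgue measurable. *)
- have mw : measurable_fun setT (fun x => enorm x `^ (2 + t) : R).
    apply: (measurableT_comp (measurable_powR _)); exact: measurable_enorm.
  move=> i j; have [mRe mIm] := psi_meas i j.
  split.
    have := lebesgue_measurable_funM mw mRe measurable_B1c.
    congr lebesgue_measurable_fun; apply/funext => x; rewrite mxE /=.
    by case: (psi x i j) => a b /=; rewrite mul0r subr0.
  have := lebesgue_measurable_funM mw mIm measurable_B1c.
  congr lebesgue_measurable_fun; apply/funext => x; rewrite mxE /=.
  by case: (psi x i j) => a b /=; rewrite mul0r addr0.
- move=> x /B1cE x1; have x0 : enorm x != 0.
    by apply: lt0r_neq0; exact: lt_le_trans x1.
  rewrite scalerA -rmorphM /= -powRD; last by rewrite x0 implybT.
  by rewrite (_ : - 2 - t + (2 + t) = 0) ?powRr0 ?scale1r//; ring.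
- move=> s s1 s43.
  (* Since [psi] is only Lebesgue measurable, |psi|^2 takes the unrestricted slot [f], and the Borel
     [dyadic_majorant] takes the slot [g]. *)
  have mu_le := @integral_le_addr_measurable _ _ _ (@lebesgue3 R) B1c
    (fun x => (cnorm ((enorm x `^ (2 + t))%:C *: psi x) `^ s * enorm x ^- 6)%:E)
    (fun x => (cnorm (psi x) ^+ 2)%:E) dyadic_majorant.
  apply: le_lt_trans (mu_le _ _ _ _ _) _.
  + move=> x; rewrite lee_fin mulr_ge0 ?powR_ge0// invr_ge0 exprn_ge0//.
    exact: enorm_ge0.
  + by move=> x; rewrite lee_fin sqr_ge0.
  + exact: dyadic_majorant_ge0.
  + exact: measurable_dyadic_majorant.
  + move=> x /B1cE x1; rewrite cnormZ ?powR_ge0//.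
    apply: (@le_trans _ _ (cnorm (psi x) ^+ 2 + enorm x ^- 4)%:E).
      (* The exponent conditions hold with room: s < 4/3 and t < 11/10 give t s < 22/15 < 2. *)
      by rewrite lee_fin weighted_powR_le ?sqrtr_ge0//; nra.
    by rewrite EFinD leeD2l// dyadic_majorant_ge.
  + by rewrite lte_add_pinfty// integral_dyadic_majorant.
Qed.
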